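(* $$\frac{105\pi}{32\sqrt3}=\sum_{j=0}^{\infty}\left(\frac14\right)^{j}\frac{\left(\frac53\right)_j(2)_j\left(\frac73\right)_j}{\left(\frac{11}{6}\right)_j\left(\frac{13}{6}\right)_j\left(\frac52\right)_j}\,(3j+4).$$
   Context: $(x)_0=1$ and $(x)_j=x(x+1)\cdots(x+j-1)$ for positive integers $j$ (rising factorial). *)

(* Defs.v *)
From Stdlib Require Import Reals.
From Coquelicot Require Import Coquelicot.
Open Scope R_scope.

Fixpoint rising_factorial (x : R) (j : nat) : R :=
  match j with
  | O => 1
  | S i => rising_factorial x i * (x + INR i)
  end.

(* Main.v *)
Require Import Defs.
From Stdlib Require Import Reals Lra Lia.
From Coquelicot Require Import Coquelicot.
Open Scope R_scope.

(** The series is a Beta-type integral of a rational function whose primitive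
    is elementary.

    Put [t = 1 - u^2].  Because [5/3, 2, 7/3] and [11/6, 13/6, 5/2] are
    arithmetic progressions of step [1/3], the quotient of the rising
    factorials in the [j]-th term is [(5)_(3j) / (11/2)_(3j)], that is,
    [315/128] times the integral of [t^(3j+4)] over [0 <= u <= 1]
    ([is_RInt_wallis], [wallis_mult3]).  The sum is therefore [315/128] times
    the integral of [sum_j (3j+4) t^(3j+4) / 4^j], which equals
    [4 t^4 (16 - t^3) / (4 - t^3)^2] ([partial_sum_remainder]); the
    remainders are nonnegative and decay geometrically, uniformly in [u]
    ([remainder_bounds]), so integrating term by term is legitimate.

    The denominator [4 - t^3] involves the cube root of 4, but as a polynomial
    in [u] it is a norm from [Q(sqrt (-3))]:
    [4 - (1 - u^2)^3 = N^2 + 3 D^2] with [N = u (3 - u^2)] and [D = 1 - u^2].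
    Hence the logarithmic part of the primitive is one multiple,
    [8 / (3 sqrt 3)], of the argument of the point [(sqrt 3 D, N)].  This
    argument grows from [0] to [PI / 2], while the rational part of the
    primitive vanishes at both ends ([is_RInt_generating]); the integral is
    thus [4 PI / (3 sqrt 3)]. *)

(** * The Beta integrals *)

Lemma rising_factorial_pos (x : R) (n : nat) :
  0 < x -> 0 < rising_factorial x n.
Proof.
  intros Hx; induction n as [|n IH]; simpl.
  - lra.
  - apply Rmult_lt_0_compat; [exact IH|].
    generalize (pos_INR n); lra.
Qed.

(** The value at [n] of the integral of [(1 - u^2)^n] over the unit
    interval, half the Beta function at [(n + 1, 1/2)]. *)
Definition wallis (n : nat) : R :=
  rising_factorial 1 n / rising_factorial (3 / 2) n.

Lemma wallis_S (n : nat) :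
  wallis (S n) = (2 * INR n + 2) / (2 * INR n + 3) * wallis n.
Proof.
  unfold wallis; simpl.
  generalize (pos_INR n); intros Hn.
  assert (H := rising_factorial_pos (3 / 2) n ltac:(lra)).
  field; repeat split; lra.
Qed.

(** [(2n+3) (1-u^2)^(n+1)] is [(2n+2) (1-u^2)^n] plus the derivative of
    [u (1-u^2)^(n+1)], which vanishes at both ends. *)
Lemma is_RInt_wallis (n : nat) :
  is_RInt (fun u => (1 - u ^ 2) ^ n) 0 1 (wallis n).
Proof.
  induction n as [|n IH].
  - unfold wallis; simpl.
    replace (1 / 1) with (scal (1 - 0) 1)
      by (unfold scal; simpl; unfold mult; simpl; field).
    apply @is_RInt_const.
  - generalize (pos_INR n); intros Hn.
    pose (f := fun u : R => u * (1 - u ^ 2) ^ S n).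
    pose (df := fun u : R => (1 - u ^ 2) ^ S n
                  - 2 * (INR n + 1) * u ^ 2 * (1 - u ^ 2) ^ n).
    assert (Hf : is_RInt df 0 1 (minus (f 1) (f 0))).
    { apply (is_RInt_derive f df); intros u _.
      - unfold f, df; auto_derive; [exact I|].
        change (match n with 0%nat => 1 | S _ => INR n + 1 end) with (INR (S n)).
        rewrite S_INR; replace (1 + - (u * (u * 1))) with (1 - u ^ 2) by ring.
        change ((1 - u ^ 2) ^ S n) with ((1 - u ^ 2) * (1 - u ^ 2) ^ n); ring.
      - apply continuity_pt_filterlim, derivable_continuous_pt.
        apply ex_derive_Reals_0; unfold df; auto_derive; exact I. }
    assert (H0 : minus (f 1) (f 0) = 0)
      by (unfold f, minus, plus, opp; simpl; ring).
    rewrite H0 in Hf.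
    assert (H := is_RInt_scal _ _ _ (/ (2 * INR n + 3)) _
      (is_RInt_plus _ _ _ _ _ _ Hf
        (is_RInt_scal _ _ _ (2 * INR n + 2) _ IH))).
    replace (wallis (S n)) with
      (scal (/ (2 * INR n + 3)) (plus 0 (scal (2 * INR n + 2) (wallis n)))).
    + revert H; apply is_RInt_ext; intros u _.
      unfold df, scal, plus; simpl; unfold mult; simpl; field; lra.
    + rewrite wallis_S; unfold scal, plus; simpl; unfold mult; simpl.
      field; lra.
Qed.

Lemma wallis_mult3 (j : nat) :
  (rising_factorial (5 / 3) j * rising_factorial 2 j * rising_factorial (7 / 3) j)
  / (rising_factorial (11 / 6) j * rising_factorial (13 / 6) j * rising_factorial (5 / 2) j)
  = 315 / 128 * wallis (3 * j + 4).
Proof.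
  induction j as [|j IH].
  - unfold wallis; simpl; field.
  - replace (3 * S j + 4)%nat with (S (S (S (3 * j + 4)))) by lia.
    rewrite !wallis_S, !S_INR.
    replace (INR (3 * j + 4)) with (3 * INR j + 4)
      by (rewrite plus_INR, mult_INR; simpl; ring).
    replace (wallis (3 * j + 4)) with (128 / 315 * (315 / 128 * wallis (3 * j + 4)))
      by field.
    rewrite <- IH; cbn [rising_factorial].
    generalize (pos_INR j); intros Hj.
    assert (H1 := rising_factorial_pos (11 / 6) j ltac:(lra)).
    assert (H2 := rising_factorial_pos (13 / 6) j ltac:(lra)).
    assert (H3 := rising_factorial_pos (5 / 2) j ltac:(lra)).
    field; repeat split; lra.
Qed.

(** * The generating function and its remainders *)

Definition generating (t : R) : R :=
  4 * t ^ 4 * (16 - t ^ 3) / (4 - t ^ 3) ^ 2.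

Definition partial_sum (n : nat) (t : R) : R :=
  sum_n (fun j => (3 * INR j + 4) * (1 / 4) ^ j * t ^ (3 * j + 4)) n.

(** The operator [t d/dt] applied to [t^4 (t^3/4)^m / (1 - t^3/4)], the tail
    of a geometric series. *)
Definition remainder (m : nat) (t : R) : R :=
  (1 / 4) ^ m * t ^ (3 * m + 4)
  * ((3 * INR m + 4) * 4 / (4 - t ^ 3) + 12 * t ^ 3 / (4 - t ^ 3) ^ 2).

Lemma remainder_step (m : nat) (t : R) :
  4 - t ^ 3 <> 0 ->
  remainder m t
  = (3 * INR m + 4) * (1 / 4) ^ m * t ^ (3 * m + 4) + remainder (S m) t.
Proof.
  intros Ht; unfold remainder.
  replace (3 * S m + 4)%nat with (3 + (3 * m + 4))%nat by lia.
  rewrite (pow_add t 3), S_INR.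
  change ((1 / 4) ^ S m) with (1 / 4 * (1 / 4) ^ m).
  field; exact Ht.
Qed.

Lemma partial_sum_remainder (n : nat) (t : R) :
  4 - t ^ 3 <> 0 -> partial_sum n t + remainder (S n) t = generating t.
Proof.
  intros Ht; unfold partial_sum; induction n as [|n IH].
  - rewrite sum_O, <- remainder_step by exact Ht.
    unfold remainder, generating; simpl; field; intros E; apply Ht; lra.
  - rewrite sum_Sn, <- IH, (remainder_step (S n)) by exact Ht.
    unfold plus; simpl; ring.
Qed.

Lemma pow_le_1 (t : R) (n : nat) : 0 <= t <= 1 -> 0 <= t ^ n <= 1.
Proof.
  intros [H0 H1]; split; [apply pow_le; exact H0|].
  rewrite <- (pow1 n); apply pow_incr; lra.
Qed.

(** The bracket in the remainder is at most [4m + 20/3] because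
    [4 - t^3 >= 3]; half of the factor [4^(-m)] absorbs this growth, since
    [m + 1 <= 2^m]. *)
Lemma remainder_bounds (m : nat) (t : R) :
  0 <= t <= 1 -> 0 <= remainder m t <= 7 * (1 / 2) ^ m.
Proof.
  intros Ht.
  assert (Hm := pos_INR m).
  assert (H3 := pow_le_1 t 3 Ht).
  assert (Hp := pow_le_1 t (3 * m + 4) Ht).
  assert (Hi : / (4 - t ^ 3) <= 1 / 3).
  { replace (1 / 3) with (/ 3) by field; apply Rinv_le_contravar; lra. }
  assert (Hi0 : 0 < / (4 - t ^ 3)) by (apply Rinv_0_lt_compat; lra).
  assert (Hq : 0 < (1 / 2) ^ m) by (apply pow_lt; lra).
  assert (Hb : (INR m + 1) * (1 / 2) ^ m <= 1).
  { clear; induction m as [|m IH].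
    - simpl; lra.
    - rewrite S_INR; simpl.
      assert (Hm := pos_INR m).
      assert (Hq : 0 < (1 / 2) ^ m) by (apply pow_lt; lra).
      nra. }
  assert (H4 : (1 / 4) ^ m = (1 / 2) ^ m * (1 / 2) ^ m)
    by (rewrite <- Rpow_mult_distr; f_equal; field).
  unfold remainder; rewrite H4.
  set (q := (1 / 2) ^ m) in *; set (p := t ^ (3 * m + 4)) in *.
  set (c := t ^ 3) in *; set (i := / (4 - c)) in *.
  replace ((3 * INR m + 4) * 4 / (4 - c) + 12 * c / (4 - c) ^ 2)
    with ((3 * INR m + 4) * 4 * i + 12 * c * (i * i))
    by (unfold i; field; lra).
  set (b := (3 * INR m + 4) * 4 * i + 12 * c * (i * i)).
  assert (Hii : 0 <= i * i <= 1 / 9) by nra.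
  assert (Hcii : 0 <= c * (i * i) <= 1 / 9) by nra.
  assert (Hbb : 0 <= b <= 7 * (INR m + 1)) by (unfold b; nra).
  assert (Hqb : 0 <= q * b <= 7) by nra.
  assert (Hpqb : 0 <= p * (q * b) <= 7) by nra.
  replace (q * q * p * b) with (q * (p * (q * b))) by ring.
  nra.
Qed.

Lemma is_RInt_partial_sum (n : nat) :
  is_RInt (fun u => partial_sum n (1 - u ^ 2)) 0 1
    (sum_n (fun j => (3 * INR j + 4) * (1 / 4) ^ j * wallis (3 * j + 4)) n).
Proof.
  unfold partial_sum; induction n as [|n IH].
  - rewrite sum_O.
    apply (is_RInt_ext (fun u => scal ((3 * INR 0 + 4) * (1 / 4) ^ 0)
                                   ((1 - u ^ 2) ^ (3 * 0 + 4)))).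
    + intros u _; rewrite sum_O; reflexivity.
    + exact (is_RInt_scal _ _ _ _ _ (is_RInt_wallis (3 * 0 + 4))).
  - rewrite sum_Sn.
    eapply is_RInt_ext; [|apply (is_RInt_plus _ _ _ _ _ _ IH
      (is_RInt_scal _ _ _ ((3 * INR (S n) + 4) * (1 / 4) ^ S n) _
         (is_RInt_wallis (3 * S n + 4))))].
    intros u _; rewrite sum_Sn; reflexivity.
Qed.

(** * The elementary primitive *)

(** With [N = u (3 - u^2)] and [D = 1 - u^2], this is [1 / sqrt 3] times the
    tangent of the argument of [(sqrt 3 D, N)] lowered by [PI / 6]: the
    rotation keeps the denominator positive on the whole unit interval, where
    [N / D] has a pole at [u = 1]. *)
Definition rotated_slope (u : R) : R :=
  (u * (3 - u ^ 2) - (1 - u ^ 2)) / (3 * (1 - u ^ 2) + u * (3 - u ^ 2)).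

(** The rational function comes from Hermite reduction; that it has a factor
    [u (1 - u^2)] is what makes the integral a pure multiple of [PI]. *)
Definition primitive (u : R) : R :=
  4 / 3 * u * (1 - u ^ 2) * (9 - 9 * u ^ 2 + 5 * u ^ 4 - u ^ 6)
    / (4 - (1 - u ^ 2) ^ 3)
  + 8 / (3 * sqrt 3) * atan (sqrt 3 * rotated_slope u).

Lemma sqrt3_pos : 0 < sqrt 3.
Proof. apply sqrt_lt_R0; lra. Qed.

Lemma sqrt3_sqr : sqrt 3 ^ 2 = 3.
Proof. apply pow2_sqrt; lra. Qed.

Lemma generating_denominator_pos (u : R) : 0 <= u <= 1 -> 0 < 4 - (1 - u ^ 2) ^ 3.
Proof. intros Hu; assert (H := pow_le_1 (1 - u ^ 2) 3 ltac:(nra)); lra. Qed.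

Lemma rotated_slope_denominator_pos (u : R) :
  0 <= u <= 1 -> 0 < 3 * (1 - u ^ 2) + u * (3 - u ^ 2).
Proof. intros Hu; nra. Qed.

Lemma is_derive_rotated_slope (u : R) :
  0 <= u <= 1 ->
  is_derive rotated_slope u
    (4 * (3 + u ^ 4) / (3 * (1 - u ^ 2) + u * (3 - u ^ 2)) ^ 2).
Proof.
  intros Hu; assert (H := rotated_slope_denominator_pos u Hu).
  unfold rotated_slope; auto_derive.
  - apply Rgt_not_eq; revert H; simpl; lra.
  - field; revert H; simpl; lra.
Qed.

(** The identity [4 - (1 - u^2)^3 = N^2 + 3 D^2] enters here, as the value of
    [1 + 3 * rotated_slope u ^ 2]. *)
Lemma is_derive_arctan_part (u : R) :
  0 <= u <= 1 ->
  is_derive (fun v => 8 / (3 * sqrt 3) * atan (sqrt 3 * rotated_slope v)) u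
    (8 / 3 * (3 + u ^ 4) / (4 - (1 - u ^ 2) ^ 3)).
Proof.
  intros Hu.
  assert (Hs := sqrt3_pos).
  assert (HD := generating_denominator_pos u Hu).
  assert (HE := rotated_slope_denominator_pos u Hu).
  assert (HY := is_derive_rotated_slope u Hu).
  assert (H := is_derive_scal _ _ (8 / (3 * sqrt 3)) _
    (is_derive_comp atan (fun v => sqrt 3 * rotated_slope v) u _ _
       (proj2 (is_derive_Reals _ _ _)
          (derivable_pt_lim_atan (sqrt 3 * rotated_slope u)))
       (is_derive_scal _ _ (sqrt 3) _ HY))).
  match type of H with is_derive _ _ ?l =>
    replace (8 / 3 * (3 + u ^ 4) / (4 - (1 - u ^ 2) ^ 3)) with l end.
  - exact H.
  - unfold scal; cbn -[pow]; unfold mult; cbn -[pow].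
    replace (1 + (sqrt 3 * rotated_slope u) ^ 2)
      with (4 * (4 - (1 - u ^ 2) ^ 3)
            / (3 * (1 - u ^ 2) + u * (3 - u ^ 2)) ^ 2).
    + field; repeat split; lra.
    + rewrite Rpow_mult_distr, sqrt3_sqr; unfold rotated_slope; field; lra.
Qed.

Lemma is_derive_primitive (u : R) :
  0 <= u <= 1 -> is_derive primitive u (generating (1 - u ^ 2)).
Proof.
  intros Hu.
  assert (HD := generating_denominator_pos u Hu).
  unfold primitive.
  replace (generating (1 - u ^ 2)) with
    ((generating (1 - u ^ 2) - 8 / 3 * (3 + u ^ 4) / (4 - (1 - u ^ 2) ^ 3))
     + 8 / 3 * (3 + u ^ 4) / (4 - (1 - u ^ 2) ^ 3)) by ring.
  apply @is_derive_plus; [|apply is_derive_arctan_part; exact Hu].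
  auto_derive.
  - apply Rgt_not_eq; revert HD; simpl; lra.
  - unfold generating; field; revert HD; simpl; lra.
Qed.

Lemma primitive_0 : primitive 0 = - (8 / (3 * sqrt 3) * (PI / 6)).
Proof.
  assert (Hs := sqrt3_pos).
  unfold primitive, rotated_slope.
  replace (sqrt 3 * _) with (- (1 / sqrt 3)).
  - rewrite atan_opp, <- tan_PI6, atan_tan by (generalize PI_RGT_0; lra).
    field; lra.
  - apply (Rmult_eq_reg_l (sqrt 3)); [|lra].
    replace (sqrt 3 * - (1 / sqrt 3)) with (- 1) by (field; lra).
    rewrite <- Rmult_assoc, sqrt_sqrt by lra.
    field.
Qed.

Lemma primitive_1 : primitive 1 = 8 / (3 * sqrt 3) * (PI / 3).
Proof.
  assert (Hs := sqrt3_pos).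
  unfold primitive, rotated_slope.
  replace (sqrt 3 * _) with (tan (PI / 3)) by (rewrite tan_PI3; field).
  rewrite atan_tan by (generalize PI_RGT_0; lra).
  field; lra.
Qed.

Lemma is_RInt_generating :
  is_RInt (fun u => generating (1 - u ^ 2)) 0 1 (4 * PI / (3 * sqrt 3)).
Proof.
  assert (Hs := sqrt3_pos).
  replace (4 * PI / (3 * sqrt 3)) with (minus (primitive 1) (primitive 0)).
  - apply (is_RInt_derive primitive); intros u;
      rewrite Rmin_left, Rmax_right by lra; intros Hu.
    + apply is_derive_primitive; exact Hu.
    + assert (HD := generating_denominator_pos u Hu).
      apply continuity_pt_filterlim, derivable_continuous_pt.
      apply ex_derive_Reals_0; unfold generating; auto_derive.
      revert HD; simpl; intros HD.
      repeat apply Rmult_integral_contrapositive_currified; lra.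
  - rewrite primitive_0, primitive_1; unfold minus, plus, opp; simpl.
    field; lra.
Qed.

(** * The sum of the series *)

Lemma partial_sum_integral_bounds (n : nat) :
  4 * PI / (3 * sqrt 3) - 7 * (1 / 2) ^ S n
  <= sum_n (fun j => (3 * INR j + 4) * (1 / 4) ^ j * wallis (3 * j + 4)) n
  <= 4 * PI / (3 * sqrt 3).
Proof.
  assert (Hu : forall u, 0 < u < 1 ->
    partial_sum n (1 - u ^ 2) + remainder (S n) (1 - u ^ 2)
      = generating (1 - u ^ 2)
    /\ 0 <= remainder (S n) (1 - u ^ 2) <= 7 * (1 / 2) ^ S n).
  { intros u Hu; split.
    - apply partial_sum_remainder, Rgt_not_eq, generating_denominator_pos; lra.
    - apply remainder_bounds; nra. }
  split.
  - assert (H := is_RInt_minus _ _ _ _ _ _ is_RInt_generating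
      (is_RInt_const 0 1 (7 * (1 / 2) ^ S n))).
    replace (4 * PI / (3 * sqrt 3) - 7 * (1 / 2) ^ S n) with
      (minus (4 * PI / (3 * sqrt 3)) (scal (1 - 0) (7 * (1 / 2) ^ S n)))
      by (unfold minus, plus, opp, scal; simpl; unfold mult; simpl; ring).
    apply (is_RInt_le _ _ 0 1 _ _ Rle_0_1 H (is_RInt_partial_sum n)).
    intros u Hu01; destruct (Hu u Hu01) as [E B].
    unfold minus, plus, opp; cbn -[pow generating partial_sum].
    lra.
  - apply (is_RInt_le _ _ 0 1 _ _ Rle_0_1 (is_RInt_partial_sum n)
             is_RInt_generating).
    intros u Hu01; destruct (Hu u Hu01) as [E B]; lra.
Qed.

Lemma is_series_wallis :
  is_series (fun j => (3 * INR j + 4) * (1 / 4) ^ j * wallis (3 * j + 4))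
    (4 * PI / (3 * sqrt 3)).
Proof.
  change (is_lim_seq
    (sum_n (fun j => (3 * INR j + 4) * (1 / 4) ^ j * wallis (3 * j + 4)))
    (4 * PI / (3 * sqrt 3))).
  apply (is_lim_seq_le_le _ _ _ _ partial_sum_integral_bounds).
  - assert (Hg : is_lim_seq (fun n => (1 / 2) ^ S n) 0).
    { apply -> is_lim_seq_incr_1.
      apply is_lim_seq_geom; rewrite Rabs_pos_eq; lra. }
    assert (H := is_lim_seq_minus' _ _ _ _
      (is_lim_seq_const (4 * PI / (3 * sqrt 3)))
      (is_lim_seq_scal_l _ 7 0 Hg)).
    rewrite Rmult_0_r, Rminus_0_r in H; exact H.
  - apply is_lim_seq_const.
Qed.

Theorem mainTheorem17 :
  is_series
    (fun j : nat =>
       (1 / 4) ^ j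
       * ((rising_factorial (5 / 3) j * rising_factorial 2 j * rising_factorial (7 / 3) j)
          / (rising_factorial (11 / 6) j * rising_factorial (13 / 6) j * rising_factorial (5 / 2) j))
       * (3 * INR j + 4))
    (105 * PI / (32 * sqrt 3)).
Proof.
  assert (Hs := sqrt3_pos).
  assert (H := is_series_scal (315 / 128) _ _ is_series_wallis).
  replace (105 * PI / (32 * sqrt 3))
    with (315 / 128 * (4 * PI / (3 * sqrt 3))) by (field; lra).
  revert H; apply is_series_ext; intros j.
  rewrite wallis_mult3; unfold scal; simpl; unfold mult; simpl; ring.
Qed.
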